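(* Let $(U_n)_{n\ge0}$ be the monic Chebyshev polynomials of the second kind, let $M\in\mathbb{R}\setminus\{0\}$, and let $$\langle\mathbf{w}_u,p\rangle=\int_0^1[p(x)+p(-x)-2p(0)]\frac{\sqrt{1-x^2}}{x^2}\,dx+M\,p(0).$$ Assume $\langle\mathbf{w}_u,U_{2n}\rangle\ne0$ for all $n\ge0$ and let $R_n=U_{n+1}+\beta_nU_{n-1}$ ($n\ge1$), where $\beta_n\in\mathbb{R}$ are such that $R_n'(0)=0$ and $\langle\mathbf{w}_u,R_n\rangle=0$ for all $n\ge1$. Then, for $n\ge1$, $R_n$ satisfies $$(1-x^2)R_n''(x)-\Big(3x-\frac{4(n+1)x(1-x^2)\beta_n}{\mathcal{B}(x;n)-\beta_n\mathcal{A}(x;n)}\Big)R_n'(x)+(n+1)\Big(n-1+\frac{4\mathcal{B}(x;n)}{\mathcal{B}(x;n)-\beta_n\mathcal{A}(x;n)}\Big)R_n(x)=0,$$ where $$\mathcal{A}(x;n)=(n+1)x^2+2n\beta_n-\frac{n+2}2,\qquad\mathcal{B}(x;n)=\frac14\Big(2n\beta_n-\frac{n+2}2\Big)-(n+1)\beta_nx^2.$$ Moreover, in the particular case $M=-\pi$ the equation reduces to $$(1-x^2)R_n''(x)-\Big(3x+\frac{2(1-x^2)}x\Big)R_n'(x)+(n+1)^2R_n(x)=0.$$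
   Context: $U_n(x)=2^{-n}\sin((n+1)\theta)/\sin\theta$, $x=\cos\theta$, so $U_0=1$, $U_1=x$, $xU_n=U_{n+1}+\frac14U_{n-1}$; they are orthogonal with respect to $\sqrt{1-x^2}\,dx$ on $(-1,1)$. The coefficients are $\beta_{2n+1}=-\langle\mathbf{w}_u,U_{2n+2}\rangle/\langle\mathbf{w}_u,U_{2n}\rangle=\frac{2(n+1)\pi-M}{4(2n\pi-M)}$ ($n\ge0$) and $\beta_{2n}=-U_{2n+1}'(0)/U_{2n-1}'(0)=\frac{n+1}{4n}$ ($n\ge1$). The differential equations are understood as identities of rational functions in $x$. *)

(* Defs.v *)
From HB Require Import structures.
From mathcomp Require Import all_boot all_order all_algebra.
From mathcomp Require Import all_classical all_reals all_analysis.
From mathcomp Require Import ring.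

Set Implicit Arguments.
Unset Strict Implicit.
Unset Printing Implicit Defensive.

Import Order.TTheory GRing.Theory Num.Theory.
Import numFieldNormedType.Exports.
Local Open Scope classical_set_scope.
Local Open Scope ring_scope.

Notation "x %:F" := (@tofrac _ x) : ring_scope.

(* U_n(cos t) = 2^-n sin((n+1)t) / sin t.  The restriction sin t != 0 only
   avoids the convention x / 0 = 0; it leaves all points of (-1, 1), so U is
   uniquely determined. *)
Definition is_monic_chebyshev2 (R : realType) (U : nat -> {poly R}) : Prop :=
  forall (n : nat) (t : R), sin t != 0 ->
    (U n).[cos t] = 2 ^- n * (sin (n.+1%:R * t) / sin t).

(* The integrand is bounded: p(x) + p(-x) - 2p(0) is divisible by x^2. *)
Definition wu (R : realType) (M : R) (p : {poly R}) : R :=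
  (\int[lebesgue_measure]_(x in `]0%R, 1%R[)
     ((p.[x] + p.[- x] - 2 * p.[0]) * (Num.sqrt (1 - x ^+ 2) / x ^+ 2)))%R
  + M * p.[0].

(* n.-1 is only meaningful for n >= 1 *)
Definition Rseq (R : realType) (U : nat -> {poly R}) (beta : nat -> R)
    (n : nat) : {poly R} :=
  U n.+1 + beta n *: U n.-1.

Definition calA (R : realType) (b : R) (n : nat) : {poly R} :=
  n.+1%:R *: 'X^2 + (2 * n%:R * b - n.+2%:R / 2)%:P.

Definition calB (R : realType) (b : R) (n : nat) : {poly R} :=
  (4^-1 * (2 * n%:R * b - n.+2%:R / 2))%:P - (n.+1%:R * b) *: 'X^2.

Definition denBA (R : realType) (b : R) (n : nat) : {poly R} :=
  calB b n - b *: calA b n.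

(* Coefficients of the differential equation
   (1 - x^2) y'' - ode_coef1 y' + ode_coef0 y = 0. *)
Definition ode_coef1 (R : realType) (b : R) (n : nat) : {fraction {poly R}} :=
  (3 *: 'X)%:F
  - ((4 * n.+1%:R * b) *: ('X * (1 - 'X^2)))%:F / (denBA b n)%:F.

Definition ode_coef0 (R : realType) (b : R) (n : nat) : {fraction {poly R}} :=
  n.+1%:R * (n%:R - 1 + (4 *: calB b n)%:F / (denBA b n)%:F).

Fixpoint chebyshev2_rec (R : realType) (n : nat) : {poly R} * {poly R} :=
  if n is m.+1 then
    let: (p, q) := chebyshev2_rec R m in (q, 'X * q - 4^-1 *: p)
  else (1, 'X).

Lemma is_monic_chebyshev2_inhabited (R : realType) :
  is_monic_chebyshev2 (fun n => (chebyshev2_rec R n).1).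
Proof.
move=> n t st; suff: (chebyshev2_rec R n).1.[cos t]
    = 2 ^- n * (sin (n.+1%:R * t) / sin t)
  /\ (chebyshev2_rec R n).2.[cos t]
    = 2 ^- n.+1 * (sin (n.+2%:R * t) / sin t) by case.
elim: n => [|n [IH1 IH2]] /=.
  rewrite hornerX (hornerC 1) mul1r divff // expr0 invr1 mul1r; split=> //.
  have -> : 2%:R * t = t + t :> R by rewrite mulr_natl mulr2n.
  by rewrite sinD expr1; field.
case: (chebyshev2_rec R n) IH1 IH2 => p q /= Hp Hq; split=> //.
rewrite hornerD hornerN hornerZ hornerM hornerX Hp Hq.
have -> : n.+3%:R * t = n.+2%:R * t + t :> R by rewrite -natr1 mulrDl mul1r.
have -> : n.+1%:R * t = n.+2%:R * t - t :> R
  by rewrite -[in RHS]natr1 mulrDl mul1r addrK.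
rewrite (sinD _ t) (sinB _ t) !exprS; field.
by rewrite st expf_neq0 ?pnatr_eq0.
Qed.

(* Main.v *)
(* Both (1 - x^2) U_n' and (1 - x^2) U_(n-1)' are combinations of U_n and
   U_(n-1) over the polynomials, so y = U_(n+1) + b U_(n-1) lies in a module of
   rank 2 stable under (1 - x^2) d/dx, and eliminating U_n and U_(n-1) from
   y, y', y'' gives the second-order equation, for every value of b: the
   denominator is never the zero polynomial.

   The two conditions on R_n only matter for M = -pi, where they force
   beta_n = (n+2)/(4n), the value at which the constant terms of calA and calB
   vanish.  For even n this comes from R_n'(0) = 0.  For odd n one needs
   <w_u, U_2k> = (-1/4)^k (M - 2 k pi).  Now <w_u, x^2 q> is the integral of
   (q(x) + q(-x)) sqrt(1 - x^2) over (0, 1); it vanishes for q = U_n with n > 0,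
   since by the Chebyshev equation the integrand is then, up to a constant, the
   derivative of (1 - x^2)^(3/2) (U_n'(x) - U_n'(-x)).  Expanding x^2 U_(n+2) in
   U_(n+4), U_(n+2), U_n gives a two-term recurrence for <w_u, U_2k>. *)
Require Import Defs.
From mathcomp Require Import all_boot all_order all_algebra.
From mathcomp Require Import all_classical all_reals all_analysis.
From mathcomp Require Import ring lra.
Set Implicit Arguments.
Unset Strict Implicit.
Unset Printing Implicit Defensive.
Import Order.TTheory GRing.Theory Num.Theory.
Import numFieldNormedType.Exports.
Local Open Scope ring_scope.

(** * Polynomial identities from values on (-1, 1) *)

Lemma poly_eq_itv (R : realFieldType) (p q : {poly R}) :
  (forall x, -1 < x < 1 -> p.[x] = q.[x]) -> p = q.
Proof.
move=> pq; apply/eqP; rewrite -subr_eq0; apply/negPn/negP => pq0.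
(* These points lie in (0, 1), and there is one more of them than the degree of [p - q] allows as
   roots. *)
pose s := [seq (i.+2%:R)^-1 | i <- iota 0 (size (p - q))] : seq R.
have : (size s < size (p - q)%R)%N.
  apply: max_poly_roots => //.
    apply/allP => _ /mapP[i _ ->]; rewrite rootE hornerD hornerN pq ?subrr//.
    have i2 : 1 < i.+2%:R :> R by rewrite ltr1n.
    have i0 : 0 < i.+2%:R :> R by rewrite ltr0n.
    by rewrite invf_lt1// i2 andbT (lt_trans (ltrN10 _))// invr_gt0.
  rewrite map_inj_uniq ?iota_uniq// => i j /invr_inj/eqP.
  by rewrite eqr_nat => /eqP[].
by rewrite size_map size_iota ltnn.
Qed.

Lemma natrSE (R : pzSemiRingType) n :
  (n.+1%:R = n%:R + 1 :> R) * (n.+2%:R = n%:R + 2 :> R) *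
  (n.+3%:R = n%:R + 3 :> R) * (n.+4%:R = n%:R + 4 :> R).
Proof. by rewrite -(addn4 n) -(addn3 n) -(addn2 n) -(addn1 n) !natrD. Qed.

(** * Recurrence and differential relations of the Chebyshev polynomials *)

Section Chebyshev.
Context {R : realType} (U : nat -> {poly R}) (hU : is_monic_chebyshev2 U).

(** Each x in (-1, 1) is the cosine of [acos x], whose sine is nonzero, so the trigonometric formula
    fixes the value at x. *)
Lemma chebyshev2_recE n : U n = (chebyshev2_rec R n).1.
Proof.
apply: poly_eq_itv => x /andP[x1 x2].
have xc : cos (acos x) = x by rewrite acosK// in_itv/= ltW// ltW.
have sx : sin (acos x) != 0.
  rewrite sin_acos; last by rewrite !ltW.
  by rewrite sqrtr_eq0 -ltNge; nra.
by rewrite -xc hU// (is_monic_chebyshev2_inhabited _ sx).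
Qed.

Lemma chebyshev2_0 : U 0 = 1.
Proof. by rewrite chebyshev2_recE. Qed.

Lemma chebyshev2_1 : U 1 = 'X.
Proof. by rewrite chebyshev2_recE. Qed.

Lemma chebyshev2_SS n : U n.+2 = 'X * U n.+1 - 4^-1 *: U n.
Proof. by rewrite !chebyshev2_recE/=; case: (chebyshev2_rec R n). Qed.

Lemma horner_chebyshev2_SS n x :
  (U n.+2).[x] = x * (U n.+1).[x] - 4^-1 * (U n).[x].
Proof. by rewrite chebyshev2_SS !hornerE. Qed.

Lemma deriv_chebyshev2 n :
  (1 - 'X^2) * (U n)^`() = n.+2%:R *: ('X * U n) - (2 * n.+1%:R) *: U n.+1.
Proof.
(* The recurrence has order two, so the induction carries two consecutive indices. *)
suff: forall x, (1 - x ^+ 2) * (U n)^`().[x]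
      = n.+2%:R * x * (U n).[x] - 2 * n.+1%:R * (U n.+1).[x] /\
    (1 - x ^+ 2) * (U n.+1)^`().[x]
      = n.+3%:R * x * (U n.+1).[x] - 2 * n.+2%:R * (U n.+2).[x].
  by move=> H; apply: poly_eq_itv => x _; have [+ _] := H x; rewrite !hornerE.
move=> x; elim: n => [|n [IH1 IH2]].
  rewrite chebyshev2_SS chebyshev2_0 chebyshev2_1 !poly.derivE !hornerE /=.
  by split; field.
split=> //; rewrite !horner_chebyshev2_SS in IH2 *.
rewrite chebyshev2_SS !poly.derivE !hornerE /= mulrDr mulrDr.
have -> : (1 - x ^+ 2) * (x * (U n.+1)^`().[x])
  = x * ((1 - x ^+ 2) * (U n.+1)^`().[x]) by ring.
by rewrite IH2 mulrN mulrCA IH1 !(natrSE R n); field.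
Qed.

Lemma horner_deriv_chebyshev2 n x : (1 - x ^+ 2) * (U n)^`().[x]
  = n.+2%:R * x * (U n).[x] - 2 * n.+1%:R * (U n.+1).[x].
Proof.
by have /(congr1 (horner^~ x)) := deriv_chebyshev2 n; rewrite !hornerE.
Qed.

Lemma horner_deriv_chebyshev2S n x : (1 - x ^+ 2) * (U n.+1)^`().[x]
  = - (n.+1%:R * x * (U n.+1).[x]) + n.+2%:R / 2 * (U n).[x].
Proof.
by rewrite horner_deriv_chebyshev2 horner_chebyshev2_SS !(natrSE R n); field.
Qed.

(** Differentiate [deriv_chebyshev2], multiply by 1 - x^2 and remove the first derivatives with the
    two relations above. *)
Lemma chebyshev2_ode n : (1 - 'X^2) * (U n)^`(2) - 3 *: ('X * (U n)^`())
  + (n%:R * n.+2%:R) *: U n = 0.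
Proof.
apply: poly_eq_itv => x /andP[x1 x2].
have D0 : 1 - x ^+ 2 != 0 by apply/eqP; nra.
have /(congr1 (fun p => p^`().[x])) := deriv_chebyshev2 n.
have h1 := horner_deriv_chebyshev2 n x.
have h2 := horner_deriv_chebyshev2S n x.
rewrite derivSn derivn1 !poly.derivE !hornerE /= => h3.
apply: (mulfI D0); rewrite mulr0.
have {}h3 : (1 - x ^+ 2) * (U n)^`()^`().[x] =
  n.+2%:R * ((U n).[x] + x * (U n)^`().[x])
  - 2 * n.+1%:R * (U n.+1)^`().[x] + 2 * x * (U n)^`().[x].
  rewrite -[RHS]addrC mulrC; move: h3; lra.
rewrite h3.
transitivity (x * (n.+2%:R - 1) * ((1 - x ^+ 2) * (U n)^`().[x])
   - 2 * n.+1%:R * ((1 - x ^+ 2) * (U n.+1)^`().[x])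
   + (1 - x ^+ 2) * (n.+2%:R * n.+1%:R) * (U n).[x]).
  by rewrite !(natrSE R n); ring.
by rewrite h1 h2 !(natrSE R n); field.
Qed.

(** The equation of the theorem at index [n.+1], multiplied by its denominator. *)
Lemma chebyshev2_sum_ode (b : R) n (y := U n.+2 + b *: U n) :
  denBA b n.+1 * ((1 - 'X^2) * y^`(2) - 3 *: 'X * y^`())
  + ((4 * n.+2%:R * b) *: ('X * (1 - 'X^2))) * y^`()
  + n.+2%:R * ((n%:R * denBA b n.+1 + 4 *: calB b n.+1) * y) = 0.
Proof.
apply: poly_eq_itv => x /andP[x1 x2].
have D0 : 1 - x ^+ 2 != 0 by apply/eqP; nra.
have h1 := horner_deriv_chebyshev2 n x.
have h2 := horner_deriv_chebyshev2S n.+1 x.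
have /(congr1 (horner^~ x)) := chebyshev2_ode n.
have /(congr1 (horner^~ x)) := chebyshev2_ode n.+2.
have natE m : (m%:R : {poly R}).[x] = m%:R by rewrite -polyC_natr hornerC.
rewrite /denBA /calB /calA {}/y !(natE, hornerD, hornerM).
rewrite !derivSn !derivn0 !poly.derivE !hornerE /= => h4 h3.
move: h1 h2 h3 h4; rewrite !horner_chebyshev2_SS.
move: (U n).[x] (U n.+1).[x] (U n)^`().[x] (U n.+2)^`().[x]
  (U n)^`()^`().[x] (U n.+2)^`()^`().[x] => v u c a c2 a2.
rewrite !(natrSE R n); move: (n%:R) => N h1 h2 h3 h4.
(* On (-1, 1) all derivatives become rational expressions in x, u and v, the values of [U n.+1] and
   [U n]; the claim is then an identity in these. *)
have divD y z : (1 - x ^+ 2) * y = z -> y = z / (1 - x ^+ 2).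
  by move=> <-; rewrite mulrC mulKf.
have ec := divD _ _ h1; have ea := divD _ _ h2.
have ec2 : c2 = (3 * x * c - N * (N + 2) * v) / (1 - x ^+ 2).
  by apply: divD; apply/eqP; rewrite -subr_eq0 -h3; apply/eqP; ring.
have ea2 : a2 =
    (3 * x * a - (N + 2) * (N + 4) * (x * u - 4^-1 * v)) / (1 - x ^+ 2).
  by apply: divD; apply/eqP; rewrite -subr_eq0 -h4; apply/eqP; ring.
by rewrite ea2 ec2 ea ec; field.
Qed.

End Chebyshev.

(** * Integrals against sqrt(1 - x^2) on (0, 1) *)

Section SqrtIntegrals.
Context {R : realType}.
Implicit Types (f F : R -> R) (p q : {poly R}).

Let mu := @lebesgue_measure R.

(** Differentiability is asked only inside the interval, because sqrt(1 - x^2) has no derivative at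
    1. *)
Lemma Rintegral_continuous_ftc01 f F : continuous f -> continuous F ->
  {in `]0, 1[, forall x : R, is_derive x 1 F (f x)} ->
  (\int[lebesgue_measure]_(x in `]0%R, 1%R[) f x)%R = F 1 - F 0.
Proof.
move=> cf cF dF.
have intf : mu.-integrable `[0%R, 1%R] (EFin \o f).
  apply: continuous_compact_integrable; first exact: segment_compact.
  by apply: continuous_subspaceT.
rewrite Rintegral_itv_bndo_bndc; last first.
  by apply: integrableS intf => //; exact/subset_itvP/subset_itv_oo_cc.
rewrite Rintegral_itv_obnd_cbnd; last first.
  by apply: integrableS intf => //; exact/subset_itvP/subset_itv_oc_cc.
rewrite /Rintegral (@continuous_FTC2 _ _ F)//.
- by apply: continuous_subspaceT.
- split.
  + by move=> x /dF[].
  + by apply: cvg_at_right_filter; exact: cF.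
  + by apply: cvg_at_left_filter; exact: cF.
- by move=> x /dF[? <-]; rewrite derive1E.
Qed.

Lemma continuous_sqrt1Bsqr :
  continuous (fun x : R => Num.sqrt (1 - x ^+ 2)).
Proof.
move=> x; apply: continuous_comp; last exact: sqrt_continuous.
apply: continuousB; first exact: cst_continuous.
exact: exprn_continuous.
Qed.

Lemma is_derive_sqrt1Bsqr (x : R) : 0 < x < 1 ->
  is_derive x 1 (fun x : R => Num.sqrt (1 - x ^+ 2))
    (- x / Num.sqrt (1 - x ^+ 2)).
Proof.
move=> /andP[x0 x1].
have D0 : 0 < 1 - x ^+ 2 by nra.
have dD : is_derive x 1 (fun x : R => 1 - x ^+ 2) (- (2 * x)).
  apply: is_derive_eq; rewrite /GRing.scale/=; ring.
have ds := is_derive1_sqrt D0.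
have dsD := @is_derive1_comp R Num.sqrt (fun x => 1 - x ^+ 2) x _ _ ds dD.
by apply: (is_derive_eq dsD); field; rewrite sqrtr_eq0 -ltNge.
Qed.

Lemma integrable_poly_sqrt p :
  mu.-integrable `]0%R, 1%R[ (EFin \o (fun x => p.[x] * Num.sqrt (1 - x ^+ 2))).
Proof.
apply: (@integrableS _ _ _ mu `[0%R, 1%R]) => //.
  exact/subset_itvP/subset_itv_oo_cc.
apply: continuous_compact_integrable; first exact: segment_compact.
apply: continuous_subspaceT => x; apply: continuousM.
  exact: continuous_horner.
exact: continuous_sqrt1Bsqr.
Qed.

Definition int_sqrt p : R :=
  (\int[lebesgue_measure]_(x in `]0%R, 1%R[)
     (p.[x] * Num.sqrt (1 - x ^+ 2)))%R.

Lemma int_sqrt_linear (c : R) p q :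
  int_sqrt (c *: p + q) = c * int_sqrt p + int_sqrt q.
Proof.
rewrite /int_sqrt -RintegralZl//; last exact: integrable_poly_sqrt.
rewrite -RintegralD//; first last.
- exact: integrable_poly_sqrt.
- rewrite (_ : _ \o _ =
      EFin \o (fun x => (c *: p).[x] * Num.sqrt (1 - x ^+ 2))).
    exact: integrable_poly_sqrt.
  by apply/funext => x /=; rewrite hornerZ; congr EFin; ring.
by apply: eq_Rintegral => x _; rewrite !hornerE /=; ring.
Qed.

Lemma int_sqrt0 : int_sqrt 0 = 0.
Proof.
have := int_sqrt_linear (-1) 0 0.
by rewrite scaler0 addr0 mulN1r addNr.
Qed.

Lemma int_sqrtZ (c : R) p : int_sqrt (c *: p) = c * int_sqrt p.
Proof. by rewrite -[c *: p]addr0 int_sqrt_linear int_sqrt0 addr0. Qed.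

(** The integrand is the derivative of (1 - x^2)^(3/2) p, which vanishes at both ends. *)
Lemma int_sqrt_derivative p : p.[0] = 0 ->
  int_sqrt ((1 - 'X^2) * p^`() - 3 *: ('X * p)) = 0.
Proof.
move=> p0; rewrite /int_sqrt.
rewrite (@Rintegral_continuous_ftc01 _
   (fun x => ((1 - 'X^2) * p).[x] * Num.sqrt (1 - x ^+ 2))).
- by rewrite !hornerE p0; ring.
- move=> x; apply: continuousM; first exact: continuous_horner.
  exact: continuous_sqrt1Bsqr.
- move=> x; apply: continuousM; first exact: continuous_horner.
  exact: continuous_sqrt1Bsqr.
move=> x; rewrite in_itv/= => x01.
have ds := is_derive_sqrt1Bsqr x01.
have D0 : 0 < 1 - x ^+ 2 by move/andP: x01 => [] *; nra.
apply: is_derive_eq; rewrite /GRing.scale/= !poly.derivE !hornerE /=.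
have := sqr_sqrtr (ltW D0).
have : Num.sqrt (1 - x ^+ 2) != 0 by rewrite sqrtr_eq0 -ltNge.
move: (Num.sqrt _) => s s0 s2.
have -> : x ^+ 2 = 1 - s ^+ 2 by rewrite s2; ring.
by field.
Qed.

Lemma int_sqrt1 : int_sqrt 1 = pi / 4.
Proof.
rewrite /int_sqrt.
pose s (x : R) := Num.sqrt (1 - x ^+ 2).
have s1_neq0 x : 1 + s x != 0 by rewrite gt_eqF// ltr_wpDr// sqrtr_ge0.
have cs : continuous s := continuous_sqrt1Bsqr.
(* atan (x / (1 + s x)) is asin x / 2, in a form that is continuous at 1. *)
rewrite (@Rintegral_continuous_ftc01 _
   (fun x => 2^-1 * (x * s x) + atan (x / (1 + s x)))).
- rewrite /s expr1n subrr sqrtr0 addr0 !mulr0 divr1 !mul0r mulr0.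
  by rewrite atan0 atan1; ring.
- move=> x; apply: continuousM; first exact: continuous_horner.
  exact: continuous_sqrt1Bsqr.
- move=> x; apply: cvgD.
    by apply: cvgM; [exact: cvg_cst|apply: cvgM; [exact: cvg_id|exact: cs]].
  apply: continuous_comp; last exact: continuous_atan.
  apply: cvgM; first exact: cvg_id.
  by apply: cvgV => //; apply: cvgD; [exact: cvg_cst|exact: cs].
move=> x; rewrite in_itv/= => x01.
have ds : is_derive x 1 s _ := is_derive_sqrt1Bsqr x01.
have D0 : 0 < 1 - x ^+ 2 by move/andP: x01 => [] *; nra.
have s0 : 0 < s x by rewrite sqrtr_gt0.
have s2 : s x ^+ 2 = 1 - x ^+ 2 by rewrite sqr_sqrtr// ltW.
have s10 := s1_neq0 x.
have s00 : s x != 0 by rewrite gt_eqF.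
have x2 : x ^+ 2 = 1 - s x ^+ 2 by rewrite s2; ring.
have dy : is_derive x 1 (fun x => x / (1 + s x)) (s x * (1 + s x))^-1.
  apply: is_derive_eq; rewrite /GRing.scale/= -/(s x).
  transitivity (x ^+ 2 / (s x * (1 + s x) ^+ 2) + (1 + s x)^-1).
    by field; rewrite s10 s00.
  by rewrite x2; field; rewrite s10 s00.
have da : is_derive x 1 (fun x => atan (x / (1 + s x))) _ :=
  is_derive1_comp (is_derive1_atan _) dy.
apply: is_derive_eq; rewrite /GRing.scale/= -/(s x) hornerC mul1r.
have -> : 1 + (x / (1 + s x)) ^+ 2 = 2 / (1 + s x).
  by rewrite expr_div_n x2; field.
transitivity (2^-1 * (s x - x ^+ 2 / s x) + 2^-1 / s x).
  by field; rewrite s10 s00.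
by rewrite x2; field.
Qed.

End SqrtIntegrals.

(** * The functional [wu] and its values on Chebyshev polynomials *)

Lemma wuE (R : realType) (M a b : R) (p : {poly R}) :
  wu M (a%:P + b *: 'X + 'X^2 * p) = int_sqrt (p + (p \Po - 'X)) + M * a.
Proof.
rewrite /wu /int_sqrt; congr (_ + _); last by rewrite !hornerE /=; ring.
(* Symmetrization kills b x, the subtraction kills a, and the remaining x^2 cancels the
   denominator. *)
apply: eq_Rintegral => x; rewrite inE/= in_itv/= => /andP[x0 _].
have x_neq0 : x != 0 by rewrite gt_eqF.
by rewrite !(hornerE, horner_comp) /=; field.
Qed.

Lemma poly_decomp2 (R : nzRingType) (p : {poly R}) :
  exists a b q, p = a%:P + b *: 'X + 'X^2 * q.
Proof.
elim/poly_ind: p => [|p a _].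
  by exists 0, 0, 0; rewrite polyC0 scale0r mulr0 !addr0.
elim/poly_ind: p => [|p b _].
  by exists a, 0, 0; rewrite scale0r mulr0 mul0r add0r !addr0.
exists a, b, p; rewrite mulrDl mul_polyC -mulrA -expr2 -commr_polyXn.
by rewrite addrC -addrA [X in _ + X]addrC addrA.
Qed.

(** Going through [wuE] replaces the integrand with 1/x^2 by one whose integrability is clear. *)
Lemma wu_linear (R : realType) (M c : R) (p q : {poly R}) :
  wu M (c *: p + q) = c * wu M p + wu M q.
Proof.
have [a [b [p2 ->]]] := poly_decomp2 p.
have [a' [b' [q2 ->]]] := poly_decomp2 q.
have -> : c *: (a%:P + b *: 'X + 'X^2 * p2) + (a'%:P + b' *: 'X + 'X^2 * q2)
  = (c * a + a')%:P + (c * b + b') *: 'X + 'X^2 * (c *: p2 + q2).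
  by rewrite -!mul_polyC !rmorphD !rmorphM/=; ring.
rewrite !wuE; have -> : c *: p2 + q2 + ((c *: p2 + q2) \Po - 'X) =
  c *: (p2 + (p2 \Po - 'X)) + (q2 + (q2 \Po - 'X)).
  by rewrite comp_polyD comp_polyZ scalerDr addrACA.
by rewrite int_sqrt_linear; ring.
Qed.

Section WuChebyshev.
Context {R : realType} (U : nat -> {poly R}) (hU : is_monic_chebyshev2 U).

Lemma int_sqrt_chebyshev2 n :
  int_sqrt (U n.+1 + (U n.+1 \Po - 'X)) = 0.
Proof.
pose q := (U n.+1)^`() - ((U n.+1)^`() \Po - 'X).
have q0 : q.[0] = 0 by rewrite !(hornerE, horner_comp) oppr0 subrr.
(* This is -m(m+2) for m = n+1, from the Chebyshev equation; it is nonzero because the index is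
   positive. *)
have c0 : - (n.+1%:R * n.+3%:R) != 0 :> R by rewrite oppr_eq0 mulf_neq0.
apply: (mulfI c0); rewrite mulr0 -(int_sqrt_derivative q0) -int_sqrtZ.
congr int_sqrt; rewrite /q.
apply: poly_eq_itv => x _.
have ode y : (1 - y ^+ 2) * (U n.+1)^`()^`().[y] =
    3 * y * (U n.+1)^`().[y] - n.+1%:R * n.+3%:R * (U n.+1).[y].
  have /(congr1 (horner^~ y)) := chebyshev2_ode hU n.+1.
  rewrite derivSn derivn1 !hornerE /= => h.
  by apply/eqP; rewrite -subr_eq0 -h; apply/eqP; ring.
have h1 := ode x; have := ode (- x); rewrite sqrrN => h2.
rewrite !poly.derivE deriv_comp !(poly.derivE, hornerE, horner_comp) /=.
transitivity ((1 - x ^+ 2) * (U n.+1)^`()^`().[x]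
  + (1 - x ^+ 2) * (U n.+1)^`()^`().[- x]
  - 3 * x * ((U n.+1)^`().[x] - (U n.+1)^`().[- x])); last by ring.
by rewrite h1 h2; ring.
Qed.

(** The recurrence in k has characteristic polynomial t^2 + t/2 + 1/16 = (t + 1/4)^2; the double
    root accounts for the factor linear in k. *)
Lemma wu_chebyshev2_even (M : R) k :
  wu M (U k.*2) = (- 4^-1) ^+ k * (M - 2 * k%:R * pi).
Proof.
suff: wu M (U k.*2) = (- 4^-1) ^+ k * (M - 2 * k%:R * pi) /\
  wu M (U k.+1.*2) = (- 4^-1) ^+ k.+1 * (M - 2 * k.+1%:R * pi) by case.
elim: k => [|k [IH1 IH2]].
  rewrite !doubleS double0.
  rewrite (chebyshev2_SS hU) (chebyshev2_0 hU) (chebyshev2_1 hU).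
  split.
    rewrite (_ : 1 = 1%:P + 0 *: 'X + 'X^2 * 0); last first.
      by rewrite scale0r mulr0 !addr0.
    by rewrite wuE comp_poly0 addr0 int_sqrt0; ring.
  rewrite (_ : _ - _ = (- 4^-1)%:P + 0 *: 'X + 'X^2 * 1); last first.
    by apply: poly_eq_itv => x _; rewrite !hornerE /=; ring.
  have -> : wu M ((- 4^-1)%:P + 0 *: 'X + 'X^2 * 1) = 2 * (pi / 4) - M / 4.
    rewrite wuE comp_polyC -int_sqrt1 -int_sqrtZ.
    by congr (int_sqrt _ + _); [rewrite scaler_nat mulr2n|ring].
  by field.
split=> //; rewrite !doubleS in IH2 *.
set n := k.*2 in IH1 IH2 *.
(* The null terms, [1 *:] and [+ 0] give the two sides the shapes expected by [wuE] and
   [wu_linear]. *)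
have /(congr1 (wu M)) : 0%:P + 0 *: 'X + 'X^2 * U n.+2
    = 1 *: U n.+4 + (2^-1 *: U n.+2 + (16^-1 *: U n + 0)).
  apply: poly_eq_itv => x _.
  by rewrite !hornerE !(horner_chebyshev2_SS hU)/=; field.
rewrite wuE int_sqrt_chebyshev2 !wu_linear IH1 IH2.
have -> : wu M 0 = 0.
  have -> : 0 = 0%:P + 0 *: 'X + 'X^2 * 0 :> {poly R}.
    by rewrite scale0r mulr0 !addr0.
  by rewrite wuE comp_poly0 addr0 int_sqrt0; ring.
rewrite mulr0 addr0 addr0 mul1r => /esym/eqP; rewrite addr_eq0 => /eqP ->.
by rewrite !exprS !(natrSE R k); field.
Qed.

Lemma chebyshev2_even0 k : (U k.*2).[0] != 0.
Proof.
elim: k => [|k IH]; first by rewrite (chebyshev2_0 hU) hornerE oner_eq0.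
rewrite doubleS (horner_chebyshev2_SS hU) mul0r sub0r oppr_eq0.
by rewrite mulf_neq0// invr_eq0.
Qed.

Lemma Rseq_coef_Npi (b : R) n :
  (U n.+2 + b *: U n)^`().[0] = 0 -> wu (- pi) (U n.+2 + b *: U n) = 0 ->
  2 * n.+1%:R * b = n.+3%:R / 2.
Proof.
rewrite -(odd_double_half n); case: (odd n); rewrite ?add0n ?add1n;
  move: n./2 => k dR wR.
(* Here n = 2k+1, and both derivatives at 0 are multiples of U_(2k)(0): the factors are k+1 for
   U_(2k+1) and -(k+2)/4 for U_(2k+3). *)
- move: dR; rewrite !poly.derivE !hornerE => dR.
  have h1 := horner_deriv_chebyshev2S hU k.*2 0.
  have := horner_deriv_chebyshev2S hU k.*2.+2 0.
  rewrite (horner_chebyshev2_SS hU k.*2) => h2.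
  move: h1 h2; rewrite expr0n/= subr0 !mul1r !mulr0 !mul0r oppr0 !add0r.
  move=> h1 h2; move: dR; rewrite h1 h2 => dR.
  apply: (mulfI (chebyshev2_even0 k)).
  apply/eqP; rewrite -subr_eq0; apply/eqP; rewrite -[RHS](mulr0 4) -[in RHS]dR.
  by rewrite !(natrSE R k.*2); field.
(* Here n = 2k. With M = -pi the values at k and k+1 have the factors -(2k+1) pi and -(2k+3) pi, so
   pi cancels. *)
- have pi0 : pi != 0 :> R by rewrite gt_eqF// pi_gt0.
  move: wR; rewrite addrC wu_linear -doubleS !wu_chebyshev2_even.
  have p0 : (- 4^-1) ^+ k * (- pi) != 0 :> R.
    by rewrite mulf_neq0 ?expf_neq0// oppr_eq0// invr_eq0.
  move=> wR; apply: (mulfI p0); apply/eqP; rewrite -subr_eq0.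
  apply/eqP; rewrite -[RHS](mulr0 2) -[in RHS]wR.
  by rewrite exprS !(natrSE R k.*2) -muln2 natrM !(natrSE R k); field.
Qed.

End WuChebyshev.

(** * The coefficients of the equation, in general and for M = -pi *)

Lemma denBA_neq0 (R : realType) (b : R) n : denBA b n != 0.
Proof.
apply/eqP => /polyP den0.
have := den0 2%N; have := den0 0%N.
rewrite /denBA /calB /calA !coefE/= => h0 h2.
(* The coefficient of X^2 is -2(n+1)b; once b = 0, the constant one is -(n+2)/8. *)
have b0 : b = 0.
  apply: (@mulfI _ (2 * n.+1%:R)); first by rewrite mulf_neq0.
  by apply/eqP; rewrite mulr0 -oppr_eq0 -[X in _ == X]h2; apply/eqP; ring.
have : n.+2%:R = 0 :> R.
  by rewrite -(mulr0 (- 8)) -[in RHS]h0 b0; field.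
by apply/eqP; rewrite pnatr_eq0.
Qed.

Section NpiCoefficients.
Context {R : realType} (b : R) (n : nat) (hb : 2 * n%:R * b = n.+2%:R / 2).

Let calB_Npi : calB b n = - (n.+1%:R * b) *: 'X^2.
Proof. by rewrite /calB hb subrr mulr0 polyC0 sub0r scaleNr. Qed.

Let denBA_Npi : denBA b n = - (2 * n.+1%:R * b) *: 'X^2.
Proof.
rewrite /denBA calB_Npi /calA hb subrr polyC0 addr0 scalerA -scalerBl.
by congr (_ *: _); ring.
Qed.

Lemma ode_coef1_Npi :
  ode_coef1 b n = (3 *: 'X)%:F + (2 *: (1 - 'X^2))%:F / 'X%:F.
Proof.
rewrite /ode_coef1; congr (_ + _); apply/eqP.
rewrite -mulNr -tofracN eqr_div ?tofrac_eq0 ?denBA_neq0 ?polyX_eq0//.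
rewrite -!tofracM tofrac_eq denBA_Npi; apply/eqP.
by rewrite -!mul_polyC !(rmorphN, rmorphM, rmorph_nat)/=; ring.
Qed.

(** Without constant terms [calB] is half of [denBA], so the quotient in [ode_coef0] is 2. *)
Lemma ode_coef0_Npi : ode_coef0 b n = n.+1%:R ^+ 2.
Proof.
have -> : ode_coef0 b n = n.+1%:R * (n%:R - 1 + 2).
  rewrite /ode_coef0; congr (_ * (_ + _)).
  have d0 : (denBA b n)%:F != 0 by rewrite tofrac_eq0 denBA_neq0.
  apply: (mulIf d0); rewrite mulfVK// -(rmorph_nat (@tofrac {poly R})) -tofracM.
  congr (_%:F); rewrite denBA_Npi calB_Npi.
  by rewrite -!mul_polyC !(rmorphN, rmorphM, rmorph_nat)/=; ring.
by rewrite -natr1; ring.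
Qed.

End NpiCoefficients.

(** * Passage to rational functions *)

Lemma linear_ode2_div (F : fieldType) (d c D t k N1 N y0 y1 y2 : F) : d != 0 ->
  d * (D * y2 - t * y1) + k * y1 + N1 * ((N * d + c) * y0) = 0 ->
  D * y2 - (t - k / d) * y1 + N1 * (N + c / d) * y0 = 0.
Proof. by move=> d0 E; apply: (mulfI d0); rewrite mulr0 -E; field. Qed.

Theorem theorem3p12 (R : realType) (U : nat -> {poly R})
    (hU : is_monic_chebyshev2 U)
    (M : R) (hM : M != 0)
    (hreg : forall n : nat, wu M (U n.*2) != 0)
    (beta : nat -> R)
    (hbeta : forall n : nat, (1 <= n)%N ->
       (Rseq U beta n)^`().[0] = 0 /\ wu M (Rseq U beta n) = 0) :
  forall n : nat, (1 <= n)%N ->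
    let Rn := Rseq U beta n in
    [/\ denBA (beta n) n != 0,
        (1 - 'X^2)%:F * (Rn^`(2))%:F - ode_coef1 (beta n) n * (Rn^`())%:F
          + ode_coef0 (beta n) n * Rn%:F = 0
      & M = - pi ->
        [/\ ode_coef1 (beta n) n = (3 *: 'X)%:F + (2 *: (1 - 'X^2))%:F / 'X%:F,
            ode_coef0 (beta n) n = n.+1%:R ^+ 2
          & (1 - 'X^2)%:F * (Rn^`(2))%:F
              - ((3 *: 'X)%:F + (2 *: (1 - 'X^2))%:F / 'X%:F) * (Rn^`())%:F
              + n.+1%:R ^+ 2 * Rn%:F = 0]].
Proof.
case=> [//|n] _ Rn.
have [dR wR] := hbeta n.+1 isT.
have ode : (1 - 'X^2)%:F * (Rn^`(2))%:F
    - ode_coef1 (beta n.+1) n.+1 * (Rn^`())%:F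
    + ode_coef0 (beta n.+1) n.+1 * Rn%:F = 0.
  apply: linear_ode2_div; first by rewrite tofrac_eq0 denBA_neq0.
  (* All scalars are moved inside [tofrac], so that the equation becomes the image of a polynomial
     identity. *)
  have -> : n.+1%:R - 1 = n%:R%:F :> {fraction {poly R}}.
    by rewrite rmorph_nat -natr1 addrK.
  rewrite -(rmorph_nat (@tofrac {poly R}) n.+2).
  rewrite -!tofracM -!tofracB -!tofracM -!tofracD -!tofracM -tofracD.
  by rewrite chebyshev2_sum_ode// tofrac0.
split=> //; first exact: denBA_neq0.
move=> MNpi; rewrite MNpi in wR.
have hb := Rseq_coef_Npi hU dR wR.
have e1 := ode_coef1_Npi hb; have e0 := ode_coef0_Npi hb.
by split=> //; rewrite -e1 -e0.
Qed.
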